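(* For any $1<p<\infty$ and any Banach space $X$ with $\dim X\ge 2$, $$H(X)\le 2^{-\frac{1}{p}}\sqrt[p]{G_{L}(X,p)}.$$
   Context: $S_X=\{x\in X:\|x\|=1\}$ denotes the unit sphere of $X$. For a Banach space $X$ with $\dim X\ge 2$ and $p\in[1,\infty)$, define $$H(X)=\sup\{\min\{\|x+y\|,\|2x-y\|\}: x,\,y,\,x-y\in S_X\},$$ $$G_L(X,p)=\sup\{\|x+y\|^{p}+\|2x-y\|^{p}: x,y\in X,\ \|x\|=\|y\|=\|x-y\|=1\}.$$ *)

(* Defs.v *)
From mathcomp Require Import all_boot all_order all_algebra.
From mathcomp Require Import boolp classical_sets reals exp normedtype.
Set Implicit Arguments.
Unset Strict Implicit.
Unset Printing Implicit Defensive.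
Import Order.TTheory GRing.Theory Num.Theory.
Import numFieldNormedType.Exports.
Local Open Scope classical_set_scope.
Local Open Scope ring_scope.

(* MathComp has no dimension for an arbitrary lmodType (vectType is finite
   dimensional), hence linear independence of two vectors is spelled out. *)
Definition dim_ge2 (R : realType) (X : normedModType R) : Prop :=
  exists x y : X,
    forall a b : R, a *: x + b *: y = 0 -> a = 0 /\ b = 0.

Definition unit_sphere (R : realType) (X : normedModType R) : set X :=
  [set x : X | `|x| = 1].
Arguments unit_sphere {R} X.

(* The two suprema below are taken in R, where [sup] is meaningful only on a
   nonempty set bounded above. Both sets are bounded (|x + y| <= 2 and
   |2 x - y| = |x + (x - y)| <= 2), and they are nonempty when X has
   dimension at least 2. *)
Definition H_const (R : realType) (X : normedModType R) : R :=
  sup [set r : R | exists x y : X,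
    [/\ unit_sphere X x, unit_sphere X y, unit_sphere X (x - y) &
        r = Num.min `|x + y| `|2 *: x - y|]].

Definition GL_const (R : realType) (X : normedModType R) (p : R) : R :=
  sup [set r : R | exists x y : X,
    [/\ `|x| = 1, `|y| = 1, `|x - y| = 1 &
        r = `|x + y| `^ p + `|2 *: x - y| `^ p]].

(* Main.v *)
Require Import Defs.
From mathcomp Require Import all_boot all_order all_algebra.
From mathcomp Require Import boolp classical_sets reals exp normedtype.
From mathcomp Require Import lra.
Import Order.TTheory GRing.Theory Num.Theory.
Import numFieldNormedType.Exports.
Local Open Scope ring_scope.

(** The minimum of two nonnegative numbers is at most their power mean of
    exponent [p]: [min_le_power_mean] gives
    [min a b <= 2^(-1/p) (a^p + b^p)^(1/p)].  For an admissible pair [(x, y)],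
    take [a = |x + y|] and [b = |2x - y|]; then [a^p + b^p] is one of the values
    over which [GL_const] is the supremum.  That supremum is a genuine upper
    bound because [a] and [b] are at most 2 by the triangle inequality
    ([powR_sum_le_GL_const]), so the right-hand side of the theorem bounds
    every minimum over which [H_const] is the supremum. *)

Lemma min_le_power_mean (R : realType) (p a b : R) :
  0 < p -> 0 <= a -> 0 <= b ->
  Num.min a b <= 2 `^ (- (1 / p)) * (a `^ p + b `^ p) `^ (1 / p).
Proof.
move=> p0 a0 b0; set m := Num.min a b.
have m0 : 0 <= m by rewrite le_min a0 b0.
have ma : m `^ p <= a `^ p.
  by apply: ge0_ler_powR; rewrite ?nnegrE ?(ltW p0) // ge_min lexx.
have mb : m `^ p <= b `^ p.
  by apply: ge0_ler_powR; rewrite ?nnegrE ?(ltW p0) // ge_min lexx orbT.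
have mean : m `^ p <= 2^-1 * (a `^ p + b `^ p) by lra.
have -> : m = (m `^ p) `^ (1 / p).
  by rewrite -powRrM mul1r divff ?gt_eqF // powRr1.
have -> : 2 `^ (- (1 / p)) = 2^-1 `^ (1 / p) :> R.
  by rewrite -[2^-1]powR_inv1 // -powRrM mulN1r.
rewrite -powRM ?invr_ge0 ?addr_ge0 ?powR_ge0 //.
have ip0 : 0 <= 1 / p by rewrite divr_ge0 // ltW.
apply: ge0_ler_powR => //.
  by rewrite nnegrE powR_ge0.
by rewrite nnegrE mulr_ge0 ?invr_ge0 ?addr_ge0 ?powR_ge0.
Qed.

(** As [sup] is only an upper bound of a bounded set, the point is that the
    values are at most [2^p + 2^p]; the second norm is controlled by writing
    [2x - y = x + (x - y)] as a sum of two unit vectors. *)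
Lemma powR_sum_le_GL_const (R : realType) (X : normedModType R) (p : R)
    (x y : X) :
  0 <= p -> `|x| = 1 -> `|y| = 1 -> `|x - y| = 1 ->
  `|x + y| `^ p + `|2 *: x - y| `^ p <= GL_const X p.
Proof.
move=> p0 x1 y1 xy1; apply: ub_le_sup; last by exists x, y.
exists (2 `^ p + 2 `^ p) => _ [u [v [u1 v1 uv1 ->]]].
apply: lerD; apply: ge0_ler_powR; rewrite ?nnegrE //.
- by rewrite (le_trans (ler_normD _ _)) // u1 v1.
- have -> : 2 *: u - v = u + (u - v) by rewrite scaler_nat mulr2n addrA.
  by rewrite (le_trans (ler_normD _ _)) // u1 uv1.
Qed.

Theorem theorem4p3 (R : realType) (X : completeNormedModType R)
    (dimX : dim_ge2 X) (p : R) (p_gt1 : 1 < p) :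
  H_const X <= 2 `^ (- (1 / p)) * (GL_const X p) `^ (1 / p).
Proof.
have p0 : 0 < p := lt_trans ltr01 p_gt1.
rewrite /H_const; set S := (S in sup S).
(* On the empty set [sup] is 0, so the bound holds there by positivity. *)
have [->|S0] := eqVneq S set0; first by rewrite sup0 mulr_ge0 ?powR_ge0.
apply: ge_sup; first exact/set0P.
move=> _ [x [y [x1 y1 xy1 ->]]].
have GL := powR_sum_le_GL_const _ _ _ _ _ (ltW p0) x1 y1 xy1.
apply: le_trans (min_le_power_mean _ _ _ _ p0 (normr_ge0 _) (normr_ge0 _)) _.
apply: ler_wpM2l; first exact: powR_ge0.
have sum_ge0 : 0 <= `|x + y| `^ p + `|2 *: x - y| `^ p.
  by rewrite addr_ge0 ?powR_ge0.
apply: ge0_ler_powR; rewrite ?nnegrE //; first by rewrite divr_ge0 // ltW.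
by rewrite (le_trans sum_ge0).
Qed.
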